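(* Let $W:\Omega^2\to[0,1]$ be a graphon and $F$ an arbitrary finite graph. Then $\mathsf{til}(F,W)=\mathsf{fcov}(F,W)$.
   Context: $(\Omega,\nu)$ is an atomless Borel probability space; a graphon is a symmetric measurable $W:\Omega^2\to[0,1]$. Let $F$ have vertex set $[k]$; $W^{\otimes F}(x_1,\dots,x_k)=\prod_{ij\in E(F),i<j}W(x_i,x_j)$ and $\mathcal{F}_F(W)=\{W^{\otimes F}\neq0\}$. An $F$-tiling in $W$ is a measurable $\mathfrak{t}:\Omega^k\to[0,\infty)$ with $\{\mathfrak{t}\neq0\}\subset\mathcal{F}_F(W)$ such that for each $x\in\Omega$, $\sum_{\ell=1}^k\int\mathfrak{t}(x_1,\dots,x_{\ell-1},x,x_{\ell+1},\dots,x_k)\,\mathrm{d}\nu^{k-1}\le1$ (integrating over all coordinates except the $\ell$-th); its size is $\int\mathfrak{t}\,\mathrm{d}\nu^k$, and $\mathsf{til}(F,W)$ is the supremum of sizes. A fractional $F$-cover of $W$ is a measurable $\mathfrak{c}:\Omega\to[0,1]$ with $\nu^k\big(\mathcal{F}_F(W)\cap\{(x_1,\dots,x_k):\sum_{i=1}^k\mathfrak{c}(x_i)<1\}\big)=0$; its size is $\int\mathfrak{c}\,\mathrm{d}\nu$, and $\mathsf{fcov}(F,W)$ is the infimum of sizes. *)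

(* Defs.v *)
From HB Require Import structures.
From mathcomp Require Import all_boot all_order all_algebra.
From mathcomp Require Import all_classical all_reals all_analysis.
Set Implicit Arguments. Unset Strict Implicit. Unset Printing Implicit Defensive.
Import Order.TTheory GRing.Theory Num.Theory.
Local Open Scope classical_set_scope.
Local Open Scope ring_scope.

Section Defs.
Context {d : measure_display} {T : measurableType d} {R : realType}.

(* Standard Borel: T is measurably isomorphic to a Borel subset of R, i.e. there
   is an injective measurable map into R sending measurable sets to measurable sets. *)
Definition standard_borel : Prop :=
  exists f : T -> R, [/\ measurable_fun [set: T] f, injective f &
    forall A : set T, measurable A -> measurable (f @` A)].

Definition atomless (nu : {measure set T -> \bar R}) : Prop :=
  forall A : set T, measurable A -> (0 < nu A)%E ->
    exists B : set T, [/\ measurable B, B `<=` A, (0 < nu B)%E & (nu B < nu A)%E].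

Definition graphon (W : T * T -> R) : Prop :=
  [/\ measurable_fun [set: T * T] W,
      forall x y, W (x, y) = W (y, x) &
      forall p, 0 <= W p <= 1].

(* Integration against the k-fold product measure nu^k, written as the
   iterated integral (which equals the product-measure integral for
   nonnegative measurable functions by Tonelli). *)
Fixpoint iter_int (nu : {measure set T -> \bar R}) (k : nat) :
  (k.-tuple T -> \bar R) -> \bar R :=
  match k return (k.-tuple T -> \bar R) -> \bar R with
  | 0 => fun f => f [tuple]
  | k'.+1 => fun f => (\int[nu]_x iter_int nu (fun t : k'.-tuple T => f [tuple of x :: t]))%E
  end.

Definition prod_meas (nu : {measure set T -> \bar R}) (k : nat) (A : set (k.-tuple T)) : \bar R :=
  iter_int nu (fun z => (\1_A z)%:E).

Definition Wtensor (k : nat) (E : rel 'I_k) (W : T * T -> R) (z : k.-tuple T) : R :=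
  \prod_(i < k) \prod_(j < k | (i < j)%N && E i j) W (tnth z i, tnth z j).

Definition FFW (k : nat) (E : rel 'I_k) (W : T * T -> R) : set (k.-tuple T) :=
  [set z | Wtensor E W z != 0].

Definition tuple_upd (k : nat) (z : k.-tuple T) (l : 'I_k) (x : T) : k.-tuple T :=
  [tuple (if j == l then x else tnth z j) | j < k].

(* \int t(x_1,..,x_{l-1},x,x_{l+1},..,x_k) d nu^{k-1}, written as a k-fold
   integral in which the l-th coordinate is ignored (nu is a probability). *)
Definition marginal (nu : {measure set T -> \bar R}) (k : nat)
    (t : k.-tuple T -> R) (l : 'I_k) (x : T) : \bar R :=
  iter_int nu (fun z => (t (tuple_upd z l x))%:E).

Definition is_tiling (nu : {measure set T -> \bar R}) (k : nat) (E : rel 'I_k)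
    (W : T * T -> R) (t : k.-tuple T -> R) : Prop :=
  [/\ measurable_fun [set: k.-tuple T] t,
      forall z, 0 <= t z,
      forall z, t z != 0 -> FFW E W z &
      forall x, (\sum_(l < k) marginal nu t l x <= 1)%E].

Definition tiling_size (nu : {measure set T -> \bar R}) (k : nat) (t : k.-tuple T -> R) : \bar R :=
  iter_int nu (fun z => (t z)%:E).

Definition til (nu : {measure set T -> \bar R}) (k : nat) (E : rel 'I_k) (W : T * T -> R) : \bar R :=
  ereal_sup [set tiling_size nu t | t in [set t | is_tiling nu E W t]].

Definition is_fcover (nu : {measure set T -> \bar R}) (k : nat) (E : rel 'I_k)
    (W : T * T -> R) (c : T -> R) : Prop :=
  [/\ measurable_fun [set: T] c,
      forall x, 0 <= c x <= 1 &
      prod_meas nu (FFW E W `&` [set z | \sum_(i < k) c (tnth z i) < 1]) = 0%E].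

Definition fcov (nu : {measure set T -> \bar R}) (k : nat) (E : rel 'I_k) (W : T * T -> R) : \bar R :=
  ereal_inf [set (\int[nu]_x (c x)%:E)%E | c in [set c | is_fcover nu E W c]].

End Defs.

(* Main.v *)
(* Linear programming duality by Hahn-Banach. For an integrable h, let p(h) be
   the infimum of a v + int w - |t| over constants a >= 0, integrable w >= 0 and
   weights t >= 0 on the copies of F with h + M t <= a + w, where v = til(F,W),
   |t| is the size of t and M t the sum of its marginals. Damping t by the
   product of a / (a + w(x_i)) turns a weight with M t <= a + w into a-times a
   tiling at a loss of at most int w, so |t| <= a v + int w; hence p is finite
   and sublinear. A linear l <= p is positive and bounded by the integral, so
   it is dominated by integration against a density c, with int c <= v and
   |t| <= int c M t for every t. Taking for t the indicator of
   {sum_i c(x_i) < 1} inside F_F(W) shows that this set is null, i.e. that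
   min(c, 1) is a fractional cover of size at most v. *)
Require Import Defs.
From HB Require Import structures.
From mathcomp Require Import all_boot all_order all_algebra.
From mathcomp Require Import all_classical all_reals all_analysis.
From mathcomp Require Import measurable_realfun.
From mathcomp Require Import ring lra.
Set Implicit Arguments. Unset Strict Implicit. Unset Printing Implicit Defensive.
Import Order.TTheory GRing.Theory Num.Theory.
Local Open Scope classical_set_scope.
Local Open Scope ring_scope.

(** * Tonelli-type calculus for iterated integrals *)

Section iter_int_theory.
Context {d : measure_display} {T : measurableType d} {R : realType}.
Variable nu : probability T R.
Local Open Scope ereal_scope.

Lemma iter_int_ge0 (k : nat) (f : k.-tuple T -> \bar R) :
  (forall z, 0 <= f z) -> 0 <= iter_int nu f.
Proof.
elim: k f => [|k IH] f f0 /=; first exact: f0.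
by apply: integral_ge0 => x _; apply: IH => z; exact: f0.
Qed.

Lemma eq_iter_int (k : nat) (f g : k.-tuple T -> \bar R) :
  f =1 g -> iter_int nu f = iter_int nu g.
Proof. by move/funext ->. Qed.

(** The parameter space is universally quantified because the induction enlarges it: the first
    coordinate of the tuple joins the parameter, the hypothesis is used over [S * T], and Tonelli
    integrates that coordinate out. *)
Lemma measurable_iter_int_param (k : nat) d' (S : measurableType d')
    (f : S * k.-tuple T -> \bar R) :
  measurable_fun setT f -> (forall z, 0 <= f z) ->
  measurable_fun setT (fun s => iter_int nu (fun z => f (s, z))).
Proof.
elim: k d' S f => [|k IH] d' S f mf f0 /=.
  by apply: measurableT_comp => //; exact/measurable_fun_pair.
pose g (p : (S * T) * k.-tuple T) := f (p.1.1, [tuple of p.1.2 :: p.2]).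
have mg : measurable_fun setT g.
  apply: (measurableT_comp mf); apply/measurable_fun_pair.
    exact: (measurableT_comp measurable_fst measurable_fst).
  apply: measurable_cons => //.
  exact: (measurableT_comp measurable_snd measurable_fst).
apply: (measurable_fun_fubini_tonelli_F
  (fun s => iter_int nu (fun z => g (s, z)))).
  exact: (IH _ _ g mg (fun z => f0 _)).
by move=> p; apply: iter_int_ge0 => z; exact: f0.
Qed.

Lemma measurable_iter_int_cons (k : nat) (f : k.+1.-tuple T -> \bar R) :
  measurable_fun setT f -> (forall z, 0 <= f z) ->
  measurable_fun setT (fun x => iter_int nu (fun z => f [tuple of x :: z])).
Proof.
move=> mf f0.
apply: (measurable_iter_int_param (f := fun p => f [tuple of p.1 :: p.2])) => //.
by apply: (measurableT_comp mf); exact: measurable_cons.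
Qed.

Lemma measurable_fun_cons (k : nat) d' (S : measurableType d') 
  (f : k.+1.-tuple T -> S) (x : T) :
  measurable_fun setT f ->
  measurable_fun setT (fun z : k.-tuple T => f [tuple of x :: z]).
Proof. by move=> mf; apply: (measurableT_comp mf); exact: measurable_cons. Qed.

Lemma ge0_iter_intD (k : nat) (f g : k.-tuple T -> \bar R) :
  measurable_fun setT f -> (forall z, 0 <= f z) ->
  measurable_fun setT g -> (forall z, 0 <= g z) ->
  iter_int nu (f \+ g) = iter_int nu f + iter_int nu g.
Proof.
elim: k f g => [//|k IH] f g mf f0 mg g0 /=.
rewrite -ge0_integralD//; try (by move=> x _; apply: iter_int_ge0);
  try exact: measurable_iter_int_cons.
apply: eq_integral => x _.
by apply: (IH (fun z => f [tuple of x :: z]) (fun z => g [tuple of x :: z])) => //;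
  exact: measurable_fun_cons.
Qed.

Lemma ge0_le_iter_int (k : nat) (f g : k.-tuple T -> \bar R) :
  measurable_fun setT f -> (forall z, 0 <= f z) ->
  measurable_fun setT g -> (forall z, f z <= g z) ->
  iter_int nu f <= iter_int nu g.
Proof.
elim: k f g => [|k IH] f g mf f0 mg fg /=; first exact: fg.
have g0 z : 0 <= g z by apply: le_trans (fg z).
apply: ge0_le_integral => //; try (by move=> x _; apply: iter_int_ge0);
  try exact: measurable_iter_int_cons.
by move=> x _; apply: IH => //; exact: measurable_fun_cons.
Qed.

Lemma ge0_iter_intZl (k : nat) (f : k.-tuple T -> \bar R) (r : R) :
  measurable_fun setT f -> (forall z, 0 <= f z) -> (0 <= r)%R ->
  iter_int nu (fun z => r%:E * f z) = r%:E * iter_int nu f.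
Proof.
move=> mf f0 r0; elim: k f mf f0 => [//|k IH] f mf f0 /=.
rewrite -ge0_integralZl_EFin//; last 2 first.
- by move=> x _; apply: iter_int_ge0.
- exact: measurable_iter_int_cons.
apply: eq_integral => x _.
by apply: (IH (fun z => f [tuple of x :: z])) => //; exact: measurable_fun_cons.
Qed.

Lemma integral_probability_cst (r : \bar R) : \int[nu]_x r = r.
Proof.
by rewrite integral_cst// -[X in _ = X]mule1; congr (_ * _); exact: probability_setT.
Qed.

Lemma iter_int_cst (k : nat) (r : \bar R) : iter_int nu (fun _ : k.-tuple T => r) = r.
Proof.
by elim: k => //= k ->; exact: integral_probability_cst.
Qed.

Lemma tuple_upd_cons0 (k : nat) (y x : T) (z : k.-tuple T) :
  tuple_upd [tuple of y :: z] ord0 x = [tuple of x :: z].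
Proof.
apply/eq_from_tnth => i; rewrite tnth_mktuple.
by case: (unliftP ord0 i) => [j ->|->]; rewrite ?eqxx // !tnthS.
Qed.

Lemma tuple_upd_consS (k : nat) (y x : T) (z : k.-tuple T) (l : 'I_k) :
  tuple_upd [tuple of y :: z] (lift ord0 l) x = [tuple of y :: tuple_upd z l x].
Proof.
apply/eq_from_tnth => i; rewrite tnth_mktuple.
by case: (unliftP ord0 i) => [j ->|->]; rewrite ?tnthS ?tnth_mktuple ?(inj_eq lift_inj).
Qed.

Lemma measurable_tuple_upd (k : nat) (l : 'I_k) :
  measurable_fun setT (fun p : T * k.-tuple T => tuple_upd p.2 l p.1).
Proof.
apply/measurable_fun_tnthP => i.
have [->|il] := eqVneq i l.
  rewrite (_ : _ \o _ = fst) //.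
  by apply/funext => -[x z] /=; rewrite tnth_mktuple eqxx.
rewrite (_ : _ \o _ = (fun z => tnth z i) \o snd) //.
  exact: (measurableT_comp (measurable_tnth i) measurable_snd).
by apply/funext => -[x z] /=; rewrite tnth_mktuple (negbTE il).
Qed.

Lemma measurable_iter_int_upd (k : nat) (f : k.-tuple T -> \bar R) (l : 'I_k) :
  measurable_fun setT f -> (forall z, 0 <= f z) ->
  measurable_fun setT (fun x => iter_int nu (fun z => f (tuple_upd z l x))).
Proof.
move=> mf f0.
apply: (measurable_iter_int_param (f := fun p => f (tuple_upd p.2 l p.1))) => //.
exact: (measurableT_comp mf (measurable_tuple_upd l)).
Qed.

(** Tonelli for one chosen coordinate: it becomes the outermost variable, while its old slot remains
    as a dummy variable of total mass one. This is what makes [marginal] integrate to the size. *)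
Lemma iter_int_upd (k : nat) (f : k.-tuple T -> \bar R) (l : 'I_k) :
  measurable_fun setT f -> (forall z, 0 <= f z) ->
  iter_int nu f = \int[nu]_x iter_int nu (fun z => f (tuple_upd z l x)).
Proof.
elim: k f l => [f []//|k IH] f l mf f0.
case: (unliftP ord0 l) => [j ->|->] /=.
  (* The induction hypothesis extracts coordinate [j] of the tail; swapping the two outer integrals
     then brings it to the front. *)
  transitivity (\int[nu]_x \int[nu]_y
    iter_int nu (fun z => f [tuple of x :: tuple_upd z j y])).
    apply: eq_integral => x _.
    by apply: (IH (fun z => f [tuple of x :: z])) => //; exact: measurable_fun_cons.
  rewrite (fubini_tonelli
    (fun p => iter_int nu (fun z => f [tuple of p.1 :: tuple_upd z j p.2])))//=.
  - apply: eq_integral => x _; apply: eq_integral => y _.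
    by apply: eq_iter_int => z; rewrite tuple_upd_consS.
  - apply: (measurable_iter_int_param
      (f := fun p => f [tuple of p.1.1 :: tuple_upd p.2 j p.1.2])) => //.
    apply: (measurableT_comp mf); apply: measurable_cons.
      exact: (measurableT_comp measurable_fst measurable_fst).
    have mu : measurable_fun setT (fun p : (T * T) * k.-tuple T => (p.1.2, p.2)).
      apply/measurable_fun_pair => //.
      exact: (measurableT_comp measurable_snd measurable_fst).
    exact: (measurableT_comp (measurable_tuple_upd j) mu).
  - by move=> p; apply: iter_int_ge0.
apply: eq_integral => x _.
(* The overwritten first coordinate reappears as an integral of a constant. *)
rewrite -[LHS]integral_probability_cst.
apply: eq_integral => y _; apply: eq_iter_int => z.
by rewrite tuple_upd_cons0.
Qed.

(** Null sets are handled one coordinate at a time: a vanishing outer integral makes the inner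
    iterated integral zero for almost every $x$, and the induction applies at each such $x$. *)
Lemma iter_int_eq0 (k : nat) (f g : k.-tuple T -> \bar R) :
  measurable_fun setT f -> (forall z, 0 <= f z) ->
  measurable_fun setT g -> (forall z, 0 <= g z) ->
  (forall z, f z = 0 -> g z = 0) -> iter_int nu f = 0 -> iter_int nu g = 0.
Proof.
elim: k f g => [|k IH] f g mf f0 mg g0 fg /=; first exact: fg.
have mF := measurable_iter_int_cons mf f0.
have mG := measurable_iter_int_cons mg g0.
have F0 x : 0 <= iter_int nu (fun z => f [tuple of x :: z]) by exact: iter_int_ge0.
have G0 x : 0 <= iter_int nu (fun z => g [tuple of x :: z]) by exact: iter_int_ge0.
move=> h.
have /(ae_eq_integral_abs nu measurableT mF) aeF :
    \int[nu]_x `|iter_int nu (fun z => f [tuple of x :: z])| = 0.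
  by rewrite -[RHS]h; apply: eq_integral => x _; rewrite gee0_abs.
rewrite (ge0_ae_eq_integral measurableT mG (measurable_cst 0)) ?integral0//.
apply: filterS aeF => x /= /(_ Logic.I) Fx _.
apply: (IH (fun z => f [tuple of x :: z])) => //; first exact: measurable_fun_cons.
  exact: measurable_fun_cons.
by move=> z; exact: fg.
Qed.

End iter_int_theory.

(** * Hahn-Banach theorem on a linear subset *)

Definition sublinear_on (R : realType) (V : lmodType R) (D : set V) (q : V -> R) :=
  (forall x y, D x -> D y -> q (x + y) <= q x + q y) /\
  (forall r x, 0 < r -> D x -> q (r *: x) <= r * q x).

Section hahn_banach.
Context {R : realType} {V : lmodType R} (D : set V).
Hypothesis DD : forall x y, D x -> D y -> D (x + y).
Hypothesis DZ : forall r x, D x -> D (r *: x).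
Implicit Types q : V -> R.

Let DN x : D x -> D (- x).
Proof. by move=> Dx; rewrite -scaleN1r; exact: DZ. Qed.

(** The reverse inequality is homogeneity applied to [r^-1] and [r *: x]. *)
Lemma sublinear_onZ q r x : sublinear_on D q -> 0 < r -> D x ->
  q (r *: x) = r * q x.
Proof.
move=> [_ qZ] r0 Dx; apply/eqP; rewrite eq_le qZ//=.
rewrite -ler_pdivlMl//.
have := qZ r^-1 (r *: x); rewrite invr_gt0 scalerA mulVf ?gt_eqF// scale1r.
by apply => //; exact: DZ.
Qed.

Lemma sublinear_on0 q x : sublinear_on D q -> D x -> q 0 = 0.
Proof.
move=> sq Dx; have D0 : D 0 by rewrite -(scale0r x); exact: DZ.
have := sublinear_onZ sq (ltr0n R 2) D0; rewrite scaler0 => /eqP.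
by rewrite mulr_natl mulr2n -subr_eq0 opprD addNKr oppr_eq0 => /eqP.
Qed.

Lemma sublinear_on_lower_bound q x : sublinear_on D q -> D x -> - q (- x) <= q x.
Proof.
move=> sq Dx; have := sq.1 x (- x) Dx (DN Dx).
by rewrite subrr (sublinear_on0 sq Dx) -lerBlDr sub0r.
Qed.

(** The function $q'(z) = \inf_{t \ge 0} (q(z + ty) - t q(y))$ is sublinear and at most $q$, so
    minimality gives $q \le q'$. Taking $t = 1$ yields $q(x) \le q(x+y) - q(y)$, the missing half of
    additivity. *)
Lemma minimal_sublinear_additive q : sublinear_on D q ->
  (forall q', sublinear_on D q' -> (forall x, D x -> q' x <= q x) ->
    forall x, D x -> q x <= q' x) ->
  forall x y, D x -> D y -> q (x + y) = q x + q y.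
Proof.
move=> sq qmin x y Dx Dy; apply/eqP; rewrite eq_le sq.1//=.
pose S z := [set q (z + t *: y) - t * q y | t in [set t : R | 0 <= t]].
have S0 z : S z !=set0 by exists (q (z + 0 *: y) - 0 * q y), 0 => /=.
have Slb z : D z -> lbound (S z) (- q (- z)).
  move=> Dz _ [t /= t0 <-]; rewrite lerNl opprB lerBlDr.
  have -> : t * q y = q (t *: y).
    move: t0; rewrite le_eqVlt => /predU1P[<-|t0].
      by rewrite mul0r scale0r (sublinear_on0 sq Dy).
    by rewrite (sublinear_onZ sq).
  have := sq.1 (- z) (z + t *: y) (DN Dz) (DD Dz (DZ _ Dy)).
  by rewrite addKr.
have Sinf z t : D z -> 0 <= t -> inf (S z) <= q (z + t *: y) - t * q y.
  move=> Dz t0; apply: ge_inf; last by exists t.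
  by exists (- q (- z)); exact: Slb.
have sq' : sublinear_on D (fun z => inf (S z)).
  split=> [z z' Dz Dz'|r z r0 Dz].
    rewrite -lerBlDr; apply: lb_le_inf => // _ [t /= t0 <-].
    rewrite lerBlDr -lerBlDl; apply: lb_le_inf => // _ [t' /= t'0 <-].
    (* Near-optimal parameters for [z] and [z'] add up to an admissible one for [z + z']. *)
    rewrite lerBlDl; apply: (le_trans (Sinf _ (t + t') (DD Dz Dz') (addr_ge0 t0 t'0))).
    rewrite addrACA -opprD -mulrDl lerB// scalerDl addrACA.
    by apply: sq.1; apply: DD => //; exact: DZ.
  rewrite -ler_pdivrMl//; apply: lb_le_inf => // _ [t /= t0 <-].
  rewrite ler_pdivrMl//.
  apply: (le_trans (Sinf _ (r * t) (DZ _ Dz) (mulr_ge0 (ltW r0) t0))).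
  rewrite mulrBr mulrA lerB// -scalerA -scalerDr.
  by apply: sq.2 => //; apply: DD => //; exact: DZ.
have le' z : D z -> inf (S z) <= q z.
  by move=> Dz; have := Sinf z 0 Dz (lexx _); rewrite scale0r mul0r addr0 subr0.
have := le_trans (qmin _ sq' le' x Dx) (Sinf x 1 Dx ler01).
by rewrite scale1r mul1r lerBrDr.
Qed.

(** Zorn's lemma gives a minimal sublinear function below $p$. It is additive by
    [minimal_sublinear_additive], hence odd, and positive homogeneity then extends to all
    scalars. *)
Lemma hahn_banach (p : V -> R) : sublinear_on D p ->
  exists l : V -> R, [/\ forall x y, D x -> D y -> l (x + y) = l x + l y,
    forall r x, D x -> l (r *: x) = r * l x &
    forall x, D x -> l x <= p x].
Proof.
move=> sp.
pose P q := sublinear_on D q /\ forall x, D x -> q x <= p x.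
pose Q := {q | P q}.
(* The order is reversed, so that a maximal element is a pointwise minimal function. *)
pose leQ (q1 q2 : Q) := `[< forall x, D x -> sval q2 x <= sval q1 x >].
have p0 : Q by exists p; split.
have [||A totA|[q [sq qp]] qmin] := @ZL_preorder Q p0 leQ.
- by move=> q; apply/asboolP => x _.
- move=> q1 q2 q3 /asboolP q21 /asboolP q13; apply/asboolP => x Dx.
  exact: le_trans (q13 _ Dx) (q21 _ Dx).
(* A nonempty chain is bounded by its pointwise infimum, which is finite because $-p(-x)$ bounds
   every member from below; the empty chain is bounded by $p$. *)
- have [[q0 Aq0]|A0] := pselect (A !=set0); last first.
    by exists p0 => q Aq; exfalso; apply: A0; exists q.
  pose S x := [set sval q x | q in A].
  have S0 x : S x !=set0 by exists (sval q0 x), q0.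
  have Sinf x (q : Q) : D x -> A q -> inf (S x) <= sval q x.
    move=> Dx Aq; apply: ge_inf; last by exists q.
    exists (- p (- x)) => _ [[/= q' [sq' q'p]] _ <-].
    apply: le_trans (sublinear_on_lower_bound sq' Dx).
    by rewrite lerN2; apply: q'p; exact: DN.
  have sm : sublinear_on D (fun x => inf (S x)).
    split=> [x y Dx Dy|r x r0 Dx].
      rewrite -lerBlDr; apply: lb_le_inf => // _ [q1 Aq1 <-].
      rewrite lerBlDr -lerBlDl; apply: lb_le_inf => // _ [q2 Aq2 <-].
      rewrite lerBlDl.
      (* Subadditivity of the infimum uses the chain condition: the smaller of [q1] and [q2] serves
         for both arguments. *)
      have [/asboolP q21|/asboolP q12] := totA _ _ Aq1 Aq2.
        apply: (le_trans (Sinf _ _ (DD Dx Dy) Aq2)).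
        apply: (le_trans ((svalP q2).1.1 _ _ Dx Dy)).
        by rewrite lerD2r q21.
      apply: (le_trans (Sinf _ _ (DD Dx Dy) Aq1)).
      apply: (le_trans ((svalP q1).1.1 _ _ Dx Dy)).
      by rewrite lerD2l q12.
    rewrite -ler_pdivrMl//; apply: lb_le_inf => // _ [q Aq <-].
    rewrite ler_pdivrMl//; apply: (le_trans (Sinf _ _ (DZ _ Dx) Aq)).
    by apply: (svalP q).1.2.
  have mp x : D x -> inf (S x) <= p x.
    by move=> Dx; apply: le_trans (Sinf _ _ Dx Aq0) ((svalP q0).2 _ Dx).
  exists (exist P _ (conj sm mp)) => q Aq; apply/asboolP => x Dx /=.
  exact: Sinf.
- have qD := minimal_sublinear_additive sq _.
  have {}qD : forall x y, D x -> D y -> q (x + y) = q x + q y.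
    apply: qD => q' sq' q'q.
    have q'p x : D x -> q' x <= p x.
      by move=> Dx; apply: le_trans (q'q _ Dx) (qp _ Dx).
    by apply/asboolP/(qmin (exist P q' (conj sq' q'p)))/asboolP.
  exists q; split => // r x Dx.
  have qN y : D y -> q (- y) = - q y.
    move=> Dy; apply/eqP; rewrite -addr_eq0 -qD ?addNr ?(sublinear_on0 sq Dy)//.
    exact: DN.
  have [r0|r0|->] := ltgtP r 0.
  + rewrite -[r]opprK scaleNr qN; last exact: DZ.
    by rewrite (sublinear_onZ sq) ?oppr_gt0// !mulNr.
  + by rewrite (sublinear_onZ sq).
  + by rewrite scale0r mul0r (sublinear_on0 sq Dx).
Qed.

End hahn_banach.

(** * Densities of positive functionals bounded by the integral *)

Section positive_functional.
Context {d : measure_display} {T : measurableType d} {R : realType}.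
Variable nu : {finite_measure set T -> \bar R}.
Let D : set (T -> R) := [set h : T -> R | nu.-integrable [set: T] (EFin \o h)].
Variable l : (T -> R) -> R.
Hypothesis lD : forall g h, D g -> D h -> l (g + h) = l g + l h.
Hypothesis lZ : forall r h, D h -> l (r *: h) = r * l h.
Hypothesis l_ge0 : forall h, D h -> (forall x, 0 <= h x) -> 0 <= l h.
Hypothesis l_le : forall h, D h -> (forall x, 0 <= h x) -> l h <= \int[nu]_x h x.

Let DI A : measurable A -> D (\1_A).
Proof. exact: integrable_indic. Qed.

Let DDh g h : D g -> D h -> D (g + h).
Proof. exact: integrableD. Qed.

Let DZh r h : D h -> D (r *: h).
Proof. exact: integrableZl. Qed.

Let D0 : D 0.
Proof. exact: integrable0. Qed.

Let l0 : l 0 = 0.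
Proof. by rewrite -(scale0r (0 : T -> R)) lZ// mul0r. Qed.

Let Dsum I (r : seq I) (F : I -> T -> R) :
  (forall i, D (F i)) -> D (\sum_(i <- r) F i).
Proof. by move=> DF; elim/big_rec: _ => // i g _; exact: DDh. Qed.

Let lsum I (r : seq I) (F : I -> T -> R) : (forall i, D (F i)) ->
  l (\sum_(i <- r) F i) = \sum_(i <- r) l (F i).
Proof.
move=> DF; elim: r => [|i r IH]; first by rewrite !big_nil.
by rewrite !big_cons lD ?IH//; exact: Dsum.
Qed.

Let lB g h : D g -> D h -> l (g - h) = l g - l h.
Proof. by move=> Dg Dh; rewrite -scaleN1r lD ?lZ ?mulN1r//; exact: DZh. Qed.

Let DBh g h : D g -> D h -> D (g - h).
Proof. by move=> Dg Dh; apply: DDh => //; rewrite -scaleN1r; exact: DZh. Qed.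

(* The maximum only matters on non-measurable sets, where [l] is unconstrained. *)
Definition functional_measure (A : set T) : \bar R := (Num.max 0 (l \1_A))%:E.
Local Notation mu := functional_measure.

Let muE A : measurable A -> mu A = (l \1_A)%:E.
Proof.
move=> mA; congr EFin; apply/max_idPr; apply: l_ge0; first exact: DI.
by move=> x; rewrite indicE.
Qed.

Let mu0 : mu set0 = 0%E.
Proof. by rewrite muE// indic0 l0. Qed.

Let mu_ge0 A : (0 <= mu A)%E.
Proof. by rewrite lee_fin le_max lexx. Qed.

(** The remainder $G_n = 1_U - \sum_{i<n} 1_{F_i}$ is nonnegative by disjointness, so $0 \le l(G_n)
    \le \int G_n\,d\nu = \nu(U) - \sum_{i<n}\nu(F_i)$. The right side tends to $0$, which squeezes
    the partial sums of $\mu$ to $l(1_U)$. *)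
Let mu_semi_sigma_additive : semi_sigma_additive mu.
Proof.
move=> F mF tF mUF; rewrite muE//.
have sumE n : (\sum_(0 <= i < n) mu (F i) =
    (l (\sum_(0 <= i < n) \1_(F i)))%:E)%E.
  rewrite lsum; last by move=> i; exact: DI.
  by rewrite -sumEFin; apply: eq_bigr => i _; rewrite muE.
pose U := \bigcup_i F i.
pose G n : T -> R := \1_U - \sum_(0 <= i < n) \1_(F i).
have G0 n x : 0 <= G n x.
  rewrite /G !fctE fct_sumE subr_ge0 big_mkord.
  have [[i Fix]|nF] := pselect (exists i : 'I_n, F i x).
    rewrite (bigD1 i)//= big1 ?addr0.
      by rewrite !indicE !mem_set//; exists i.
    move=> j ji; rewrite indicE memNset// => Fjx.
    have := tF j i Logic.I Logic.I => /(_ (ex_intro _ x (conj Fjx Fix))) /ord_inj ij.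
    by rewrite ij eqxx in ji.
  by rewrite big1// => i _; rewrite indicE memNset// => Fix; apply: nF; exists i.
have DG n : D (G n) by apply: DBh; [exact: DI|apply: Dsum => i; exact: DI].
have nuG n : (\int[nu]_x G n x)%:E = (nu U - \sum_(0 <= i < n) nu (F i))%E.
  rewrite /Rintegral fineK; last exact: (integrable_fin_num _ (DG n)).
  under eq_integral do rewrite /G !fctE EFinB.
  rewrite integralB//; [|exact: DI|by apply: Dsum => i; exact: DI].
  rewrite integral_indic// setIT; congr (_ - _)%E.
  under eq_integral do rewrite fct_sumE -sumEFin.
  rewrite ge0_integral_sum//.
    by apply: eq_bigr => i _; rewrite integral_indic// setIT.
  by move=> i; exact/measurable_EFinP.
have lG n : l (G n) = l \1_U - l (\sum_(0 <= i < n) \1_(F i)).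
  by apply: lB; [exact: DI|apply: Dsum => i; exact: DI].
have nuUfin : nu U \is a fin_num by exact: fin_num_measure.
apply: (@squeeze_cvge _ _ _ _ (fun n => (l \1_U)%:E - nu U + \sum_(0 <= i < n) nu (F i))%E
   _ (fun _ => (l \1_U)%:E)).
- apply: nearW => n; rewrite sumE; apply/andP; split; last first.
    by rewrite lee_fin -subr_ge0 -lG; exact: l_ge0.
  have := l_le (DG n) (G0 n).
  rewrite -lee_fin lG nuG.
  have : (\sum_(0 <= i < n) nu (F i))%E \is a fin_num.
    by rewrite sum_fin_num; apply/allP => _ /mapP[i _ ->]; exact: fin_num_measure.
  move: nuUfin => /fineK <- /fineK <-; rewrite -!(EFinB, EFinD) !lee_fin.
  lra.
- rewrite -[X in _ --> X](subeK (l \1_U)%:E nuUfin).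
  apply: cvgeD; [by rewrite fin_num_adde_defl|exact: cvg_cst|].
  exact: measure_semi_sigma_additive.
- exact: cvg_cst.
Qed.

HB.instance Definition _ := isMeasure.Build _ _ _ mu mu0 mu_ge0 mu_semi_sigma_additive.

Let mu_fin : fin_num_fun mu.
Proof. by move=> A mA. Qed.

HB.instance Definition _ := @Measure_isFinite.Build _ _ _ mu mu_fin.

Let mu_dominated : mu `<< nu.
Proof.
apply/null_content_dominatesP => A mA nuA; apply/eqP; rewrite eq_le mu_ge0 andbT.
rewrite muE// lee_fin.
have I0 x : 0 <= (\1_A x : R) by rewrite indicE.
apply: (le_trans (l_le (DI mA) I0)).
by rewrite /Rintegral integral_indic// setIT nuA.
Qed.

Import HBNNSimple.

Let l_nnsfun (s : {nnsfun T >-> R}) : (l s)%:E = (\int[mu]_x (s x)%:E)%E.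
Proof.
have sE : (s : T -> R) =
    \sum_(y <- finmap.enum_fset (fset_set (range s))) y *: (\1_(s @^-1` [set y]) : T -> R).
  by apply/funext => x; rewrite fct_sumE fimfunE fsbig_finite.
have mS y : measurable (s @^-1` [set y]).
  by rewrite -[X in measurable X]setTI; apply: measurable_funP.
rewrite integralT_nnsfun sintegralE fsbig_finite// [in LHS]sE lsum; last first.
  by move=> y; apply: DZh; exact: DI.
by rewrite -sumEFin; apply: eq_bigr => y _; rewrite lZ; [rewrite EFinM -muE|exact: DI].
Qed.

(** Choose a simple $s \le h$ whose $\nu$-integral is within $e$ of that of $h$. Then $l(h) = l(s) +
    l(h - s)$, where $l(s) = \int s\,d\mu \le \int h\,d\mu$ and $l(h-s) \le \int (h-s)\,d\nu \le
    e$. *)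
Let l_le_mu h : D h -> (forall x, 0 <= h x) -> ((l h)%:E <= \int[mu]_x (h x)%:E)%E.
Proof.
move=> Dh h0; have mh : measurable_fun setT h by exact/measurable_EFinP/measurable_int/Dh.
have h0' x : (0 <= (EFin \o h) x)%E by rewrite lee_fin.
have Ih : (\int[nu]_x (h x)%:E)%E \is a fin_num by exact: integrable_fin_num Dh.
apply/lee_addgt0Pr => e e0.
pose S := [set sintegral nu s | s in
  [set s : {nnsfun T >-> R} | forall x, ((s x)%:E <= (h x)%:E)%E]].
have IS : (\int[nu]_x (h x)%:E)%E = ereal_sup S by exact: ge0_integralTE.
have := @ub_ereal_sup_adherent _ S _ e0; rewrite -IS => /(_ Ih)[_ [s sh <-]].
rewrite -integralT_nnsfun => hs.
have s0 x : 0 <= s x by exact: fun_ge0.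
have Ds : D s.
  apply: le_integrable Dh => //; first exact/measurable_EFinP.
  by move=> x _ /=; rewrite lee_fin !ger0_norm// -lee_fin; exact: sh.
have sh' x : 0 <= (h - (s : T -> R)) x by rewrite !fctE subr_ge0 -lee_fin; exact: sh.
have : l (h - (s : T -> R)) <= e.
  apply: (le_trans (l_le (DBh Dh Ds) sh')).
  rewrite -lee_fin /Rintegral fineK; last exact: integrable_fin_num (DBh Dh Ds).
  under eq_integral do rewrite !fctE EFinB.
  rewrite integralB//.
  have : (\int[nu]_x (s x)%:E)%E \is a fin_num by exact: integrable_fin_num Ds.
  move=> Is; move: hs; rewrite -(fineK Ih) -(fineK Is) -!EFinB lte_fin lee_fin; lra.
rewrite lB// lerBlDl -lee_fin EFinD => /le_trans; apply.
rewrite leeD2r// l_nnsfun; apply: ge0_le_integral => //.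
- by move=> x _; rewrite lee_fin.
- exact/measurable_EFinP.
- exact/measurable_EFinP.
Qed.

(** The density is the Radon-Nikodym derivative of $\mu(A) = l(1_A)$ with respect to $\nu$; its
    integral is the total mass $\mu(\Omega) = l(1)$. *)
Lemma positive_functional_density : exists c : T -> R,
  [/\ measurable_fun [set: T] c, forall x, 0 <= c x,
      (\int[nu]_x (c x)%:E = (l (cst 1))%:E)%E &
      forall h, D h -> (forall x, 0 <= h x) ->
        ((l h)%:E <= \int[nu]_x (h x * c x)%:E)%E].
Proof.
pose f := Radon_Nikodym_SigmaFinite.f mu nu.
have fE x : f x = (fine (f x))%:E.
  by rewrite fineK//; exact: Radon_Nikodym_SigmaFinite.f_fin_num.
have mf : measurable_fun setT f.
  exact: measurable_int (Radon_Nikodym_SigmaFinite.f_integrable mu_dominated).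
exists (fine \o f); split.
- exact: measurableT_comp.
- by move=> x; apply: fine_ge0; exact: Radon_Nikodym_SigmaFinite.f_ge0.
- under eq_integral do rewrite /= -fE.
  rewrite -Radon_Nikodym_SigmaFinite.f_integral//.
  by rewrite -[LHS]/(functional_measure _) muE// indicT.
- move=> h Dh h0; under eq_integral do rewrite /= EFinM -fE.
  rewrite Radon_Nikodym_SigmaFinite.change_of_variables//; first exact: l_le_mu.
  exact: measurable_int Dh.
Qed.

End positive_functional.

(** * Marginals of weights on tuples *)

Section tilings.
Context {d : measure_display} {T : measurableType d} {R : realType}.
Variable nu : probability T R.
Context {k : nat}.
Implicit Types (t : k.-tuple T -> R) (c g : T -> R) (x : T) (z : k.-tuple T).

Definition marginal_sum t x : \bar R := (\sum_(l < k) marginal nu t l x)%E.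

Lemma marginal_ge0 t l x : (forall z, 0 <= t z) -> (0 <= marginal nu t l x)%E.
Proof. by move=> t0; apply: iter_int_ge0 => z; rewrite lee_fin. Qed.

Lemma marginal_sum_ge0 t x : (forall z, 0 <= t z) -> (0 <= marginal_sum t x)%E.
Proof. by move=> t0; apply: sume_ge0 => l _; exact: marginal_ge0. Qed.

Lemma measurable_marginal t l : measurable_fun setT t -> (forall z, 0 <= t z) ->
  measurable_fun setT (marginal nu t l).
Proof.
move=> mt t0; apply: (measurable_iter_int_upd nu (f := EFin \o t)) => //.
exact/measurable_EFinP.
Qed.

Lemma measurable_marginal_sum t : measurable_fun setT t -> (forall z, 0 <= t z) ->
  measurable_fun setT (marginal_sum t).
Proof.
by move=> mt t0; apply: emeasurable_sum => l; exact: measurable_marginal.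
Qed.

Lemma measurable_EFin_upd t (l : 'I_k) x : measurable_fun setT t ->
  measurable_fun setT (fun z => (t (tuple_upd z l x))%:E).
Proof.
move=> mt; apply/measurable_EFinP.
have mu : measurable_fun setT (fun z : k.-tuple T => (x, z)).
  exact/measurable_fun_pair.
exact: (measurableT_comp mt (measurableT_comp (measurable_tuple_upd l) mu)).
Qed.

Lemma marginal_sumD t t' x : measurable_fun setT t -> (forall z, 0 <= t z) ->
  measurable_fun setT t' -> (forall z, 0 <= t' z) ->
  (marginal_sum (t \+ t')%R x = marginal_sum t x + marginal_sum t' x)%E.
Proof.
move=> mt t0 mt' t'0; rewrite /marginal_sum -big_split; apply: eq_bigr => l _ /=.
rewrite /marginal -ge0_iter_intD//; try exact: measurable_EFin_upd.
all: by move=> z; rewrite lee_fin.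
Qed.

Lemma marginal_sumZ t r x : measurable_fun setT t -> (forall z, 0 <= t z) ->
  0 <= r -> (marginal_sum (fun z => r * t z)%R x = r%:E * marginal_sum t x)%E.
Proof.
move=> mt t0 r0; rewrite /marginal_sum ge0_sume_distrr; last first.
  by move=> l _; exact: marginal_ge0.
apply: eq_bigr => l _.
rewrite /marginal -ge0_iter_intZl//; first exact: measurable_EFin_upd.
by move=> z; rewrite lee_fin.
Qed.

Lemma measurable_sum_tnth g : measurable_fun setT g ->
  measurable_fun setT (fun z => \sum_(l < k) g (tnth z l)).
Proof.
move=> mg; apply: measurable_sum => l.
exact: (measurableT_comp mg (measurable_tnth l)).
Qed.

(** Taking marginal sums is adjoint to $g \mapsto \sum_i g(x_i)$: apply [iter_int_upd] to each
    coordinate in turn. *)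
Lemma integral_marginal_sum t g : measurable_fun setT t -> (forall z, 0 <= t z) ->
  measurable_fun setT g -> (forall x, 0 <= g x) ->
  (\int[nu]_x ((g x)%:E * marginal_sum t x) =
   iter_int nu (fun z => (t z * \sum_(l < k) g (tnth z l))%:E))%E.
Proof.
move=> mt t0 mg g0.
have mgl l : measurable_fun setT (fun z => (t z * g (tnth z l))%:E).
  apply/measurable_EFinP; apply: measurable_funM => //.
  exact: (measurableT_comp mg (measurable_tnth l)).
have gl0 l z : (0 <= (t z * g (tnth z l))%:E)%E by rewrite lee_fin mulr_ge0.
transitivity (\sum_(l < k) iter_int nu (fun z => (t z * g (tnth z l))%:E))%E.
  under eq_integral => x _.
    rewrite ge0_sume_distrr; last by move=> l _; exact: marginal_ge0.
    over.
  rewrite ge0_integral_sum//; last 2 first.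
  - move=> l; apply: emeasurable_funM; first exact/measurable_EFinP.
    exact: measurable_marginal.
  - by move=> l x _; apply: mule_ge0; rewrite ?lee_fin//; exact: marginal_ge0.
  apply: eq_bigr => l _; rewrite (iter_int_upd nu l (mgl l) (gl0 l)).
  apply: eq_integral => x _; rewrite /marginal -ge0_iter_intZl//.
  - apply: eq_iter_int => z; rewrite tnth_mktuple eqxx.
    by rewrite mulrC EFinM.
  - exact: measurable_EFin_upd.
  - by move=> z; rewrite lee_fin.
rewrite -big_enum /=; under eq_iter_int do rewrite -big_enum /= mulr_sumr.
elim: (enum _) => [|l s IH].
  rewrite big_nil -[LHS](iter_int_cst nu k); apply: eq_iter_int => z.
  by rewrite big_nil.
rewrite big_cons IH -ge0_iter_intD//.
- by apply: eq_iter_int => z /=; rewrite big_cons EFinD.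
- apply/measurable_EFinP; apply: measurable_sum => i.
  by apply/measurable_EFinP; exact: (mgl i).
- by move=> z; rewrite lee_fin sumr_ge0// => i _; rewrite -lee_fin.
Qed.

(** The adjunction with $g = 1$ shows that the right side is $k$ times the size. *)
Lemma tiling_size_le_marginal_sum t : (0 < k)%N ->
  measurable_fun setT t -> (forall z, 0 <= t z) ->
  (tiling_size nu t <= \int[nu]_x marginal_sum t x)%E.
Proof.
move=> k0 mt t0.
have m1 : measurable_fun [set: T] (cst 1 : T -> R) by exact: measurable_cst.
have := integral_marginal_sum mt t0 m1 (fun _ => ler01).
under eq_integral do rewrite mul1e.
move=> ->; apply: ge0_le_iter_int.
- exact/measurable_EFinP.
- by move=> z; rewrite lee_fin.
- apply/measurable_EFinP; apply: measurable_funM => //.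
  exact: (measurable_sum_tnth m1).
- move=> z; rewrite lee_fin sumr_const card_ord ler_peMr// ler1n.
  exact: k0.
Qed.

(** * Weak duality and damping of weights *)

Section fixed_graph.
Variables (E : rel 'I_k) (W : T * T -> R).
Hypothesis mW : measurable_fun [set: T * T] W.

Lemma measurable_FFW : measurable (FFW E W : set (k.-tuple T)).
Proof.
have mWt : measurable_fun setT (Wtensor E W : k.-tuple T -> R).
  rewrite /Wtensor; apply: measurable_prod => i _.
  pose J := seq.filter (fun j : 'I_k => (i < j)%N && E i j) (index_enum _).
  rewrite (_ : (fun _ => _) = fun z => \prod_(j <- J) W (tnth z i, tnth z j)).
    apply: measurable_prod => j _; apply: (measurableT_comp mW).
    by apply/measurable_fun_pair; exact: measurable_tnth.
  by apply/funext => z; rewrite big_filter.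
rewrite (_ : FFW E W = Wtensor E W @^-1` (~` [set 0])).
  by rewrite -[X in measurable X]setTI; apply: mWt => //; exact: measurableC.
by apply/seteqP; split => z /= /eqP.
Qed.

Let mdefect c : measurable_fun setT c ->
  measurable (FFW E W `&` [set z : k.-tuple T | \sum_(i < k) c (tnth z i) < 1]).
Proof.
move=> mc; apply: measurableI; first exact: measurable_FFW.
rewrite -[X in measurable X]setTI.
have m1 : measurable_fun setT (cst 1 : k.-tuple T -> R) by exact: measurable_cst.
have := measurable_fun_ltr (measurable_sum_tnth mc) m1.
by move=> /(_ measurableT [set true] I).
Qed.

(** Let $S(z) = \sum_i c(z_i)$ and let $B$ be the null set where the cover fails. Pointwise $t \le
    tS + t 1_B$; the second term integrates to $0$ and the first to $\int c\,Mt \le \int c$. *)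
Lemma tiling_size_le_fcover t c : is_tiling nu E W t -> is_fcover nu E W c ->
  (tiling_size nu t <= \int[nu]_x (c x)%:E)%E.
Proof.
move=> [mt t0 tA tM] [mc c01 cA].
have c0 x : 0 <= c x by case/andP: (c01 x).
set B := _ `&` _ in cA; have mB : measurable B by exact: mdefect.
pose S z := \sum_(l < k) c (tnth z l).
have mS : measurable_fun setT S by exact: measurable_sum_tnth.
have S0 z : 0 <= S z by apply: sumr_ge0.
have mtS : measurable_fun setT (fun z => (t z * S z)%:E).
  exact/measurable_EFinP/measurable_funM.
have mtB : measurable_fun setT (fun z => (t z * \1_B z)%:E).
  by apply/measurable_EFinP/measurable_funM.
have IB0 z : (0 <= \1_B z :> R) by rewrite indicE.
have tB : iter_int nu (fun z => (t z * \1_B z)%:E) = 0%E.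
  apply: (iter_int_eq0 (f := fun z => (\1_B z)%:E)) => //.
  - exact/measurable_EFinP.
  - by move=> z; rewrite lee_fin mulr_ge0.
  - by move=> z [->]; rewrite mulr0.
have -> : (\int[nu]_x (c x)%:E = \int[nu]_x ((c x)%:E * 1))%E.
  by apply: eq_integral => x _; rewrite mule1.
apply: (@le_trans _ _ (\int[nu]_x ((c x)%:E * marginal_sum t x))%E); last first.
  apply: ge0_le_integral => //.
  - by move=> x _; apply: mule_ge0; rewrite ?lee_fin//; exact: marginal_sum_ge0.
  - apply: emeasurable_funM; first exact/measurable_EFinP.
    exact: measurable_marginal_sum.
  - by apply: emeasurable_funM => //; exact/measurable_EFinP.
  - by move=> x _; apply: lee_wpmul2l; [rewrite lee_fin|exact: tM].
rewrite integral_marginal_sum// -[leRHS]adde0 -tB -ge0_iter_intD//; last 2 first.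
- by move=> z; rewrite lee_fin; apply: mulr_ge0 => //; exact: S0.
- by move=> z; rewrite lee_fin mulr_ge0.
apply: ge0_le_iter_int.
- exact/measurable_EFinP.
- by move=> z; rewrite lee_fin.
- exact: emeasurable_funD.
- move=> z; rewrite -EFinD lee_fin -mulrDr.
  have [->|tz] := eqVneq (t z) 0; first by rewrite mul0r.
  apply: ler_peMr => //; have [S1|S1] := leP 1 (S z).
    by rewrite (le_trans S1)// lerDl.
  have Bz : B z by split => //; exact: tA.
  by rewrite indicE mem_set// lerDr; exact: S0.
Qed.

(** Weierstrass product inequality; it bounds the mass lost when a weight is multiplied by a product
    of factors in $[0,1]$. *)
Let le_one_prod (I : Type) (s : seq I) (F : I -> R) :
  (forall i, 0 <= F i <= 1) ->
  1 <= \prod_(i <- s) F i + \sum_(i <- s) (1 - F i).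
Proof.
move=> F01; elim: s => [|i s IH]; first by rewrite !big_nil addr0.
rewrite !big_cons; set P := \prod_(_ <- _) _ in IH *.
set S := \sum_(_ <- _) _ in IH *.
have P1 : P <= 1 by apply: Num.Theory.prodr_ile1 => j _; exact: F01.
have /andP[F0 F1] := F01 i.
nra.
Qed.

(** With $\phi = a/(a+w)$, the weight $t' = a^{-1} t \prod_i \phi(x_i)$ is a tiling, since $Mt' \le
    a^{-1}\phi\,(a+w) = 1$. By [le_one_prod], $t \le a t' + t\sum_i(1-\phi(x_i))$, and the last term
    integrates to $\int (1-\phi)\,Mt \le \int (1-\phi)(a+w) = \int w$. *)
Lemma tiling_size_perturbation (v a : R) t (w : T -> R) : (0 < k)%N ->
  (forall t, is_tiling nu E W t -> (tiling_size nu t <= v%:E)%E) ->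
  measurable_fun setT t -> (forall z, 0 <= t z) ->
  (forall z, t z != 0 -> FFW E W z) ->
  0 <= a -> measurable_fun setT w -> (forall x, 0 <= w x) ->
  (forall x, (marginal_sum t x <= (a + w x)%:E)%E) ->
  (tiling_size nu t <= (a * v)%:E + \int[nu]_x (w x)%:E)%E.
Proof.
move=> k0 tilv mt t0 tA a0 mw w0 tw.
have mM := measurable_marginal_sum mt t0.
move: a0; rewrite le_eqVlt => /predU1P[a0|a0].
  rewrite -a0 mul0r add0e (le_trans (tiling_size_le_marginal_sum k0 mt t0))//.
  apply: ge0_le_integral => //.
  - by move=> x _; exact: marginal_sum_ge0.
  - exact/measurable_EFinP.
  - by move=> x _; have := tw x; rewrite -a0 add0r.
pose phi x := a / (a + w x).
have aw0 x : 0 < a + w x by rewrite ltr_wpDr.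
have phi0 x : 0 <= phi x by rewrite divr_ge0// ltW.
have phi1 x : phi x <= 1 by rewrite ler_pdivrMr// mul1r lerDl.
have phi01 x : 0 <= phi x <= 1 by rewrite phi0 phi1.
have mphi : measurable_fun setT phi.
  rewrite (_ : phi = fun x => a * (a + w x) `^ (-1)).
    apply: measurable_funM => //; apply: (measurableT_comp (measurable_powR _)).
    exact: measurable_funD.
  by apply/funext => x; rewrite powR_inv1// ltW.
pose P z := \prod_(i < k) phi (tnth z i).
have P0 z : 0 <= P z by apply: prodr_ge0.
have mP : measurable_fun setT P.
  apply: measurable_prod => i _.
  exact: (measurableT_comp mphi (measurable_tnth i)).
pose t' z := a^-1 * (t z * P z).
have t'0 z : 0 <= t' z by apply: mulr_ge0; [rewrite invr_ge0 ltW|apply: mulr_ge0].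
have mt' : measurable_fun setT t'.
  by apply: measurable_funM => //; apply: measurable_funM.
(* Once coordinate [l] is fixed to [x], its factor is [phi x] and the other factors are at most
   $1$. *)
have marg l x : (marginal nu t' l x <= (a^-1 * phi x)%:E * marginal nu t l x)%E.
  rewrite /marginal -ge0_iter_intZl//; last 3 first.
  - exact: measurable_EFin_upd.
  - by move=> z; rewrite lee_fin.
  - by rewrite mulr_ge0// invr_ge0 ltW.
  apply: ge0_le_iter_int.
  - exact: measurable_EFin_upd.
  - by move=> z; rewrite lee_fin.
  - by apply: emeasurable_funM => //; exact: measurable_EFin_upd.
  - move=> z; rewrite -EFinM lee_fin /t' -mulrA.
    apply: ler_wpM2l; first by rewrite invr_ge0 ltW.
    rewrite mulrC ler_wpM2r// /P (bigD1 l)//= tnth_mktuple eqxx ler_piMr//.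
    by rewrite Num.Theory.prodr_ile1// => i _; exact: phi01.
have tilt' : is_tiling nu E W t'.
  split => //.
    move=> z; rewrite /t' => t'z; apply: tA; apply: contraNneq t'z => ->.
    by rewrite mul0r mulr0.
  move=> x; apply: (@le_trans _ _ ((a^-1 * phi x)%:E * marginal_sum t x)%E).
    rewrite ge0_sume_distrr; last by move=> l _; exact: marginal_ge0.
    exact: lee_sum.
  apply: (@le_trans _ _ ((a^-1 * phi x)%:E * (a + w x)%:E)%E).
    by apply: lee_wpmul2l => //; rewrite lee_fin mulr_ge0// invr_ge0 ltW.
  by rewrite -EFinM lee_fin -mulrA divfK ?gt_eqF// mulVf ?gt_eqF.
pose Q z := \sum_(i < k) (1 - phi (tnth z i)).
have mphi' : measurable_fun setT (fun x => 1 - phi x).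
  exact: measurable_funB.
have phi'0 x : 0 <= 1 - phi x by rewrite subr_ge0.
have mQ : measurable_fun setT Q by exact: (measurable_sum_tnth mphi').
have Q0 z : 0 <= Q z by apply: sumr_ge0.
apply: (@le_trans _ _ (iter_int nu (fun z => (a * t' z)%:E) +
    iter_int nu (fun z => (t z * Q z)%:E))%E).
  rewrite -ge0_iter_intD//.
  - apply: ge0_le_iter_int.
    + exact/measurable_EFinP.
    + by move=> z; rewrite lee_fin.
    + apply: emeasurable_funD; apply/measurable_EFinP; exact: measurable_funM.
    + move=> z; rewrite -EFinD lee_fin mulVKf ?gt_eqF// -mulrDr ler_peMr//.
      by apply: le_one_prod => i.
  - by apply/measurable_EFinP; exact: measurable_funM.
  - by move=> z; rewrite lee_fin mulr_ge0// ltW.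
  - by apply/measurable_EFinP; exact: measurable_funM.
  - by move=> z; rewrite lee_fin mulr_ge0.
apply: leeD.
  under eq_iter_int do rewrite EFinM.
  rewrite ge0_iter_intZl//.
  - by rewrite EFinM; apply: lee_wpmul2l; [rewrite lee_fin ltW|exact: tilv].
  - exact/measurable_EFinP.
  - exact: ltW.
rewrite /Q -(integral_marginal_sum mt t0 mphi' phi'0); apply: ge0_le_integral => //.
- by move=> x _; apply: mule_ge0; rewrite ?lee_fin//; exact: marginal_sum_ge0.
- by apply: emeasurable_funM => //; exact/measurable_EFinP.
- exact/measurable_EFinP.
- move=> x _; apply: (@le_trans _ _ ((1 - phi x)%:E * (a + w x)%:E)%E).
    by apply: lee_wpmul2l; rewrite ?lee_fin.
  by rewrite -EFinM lee_fin mulrBl mul1r divfK ?gt_eqF// addrAC subrr add0r.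
Qed.

(** * The sublinear budget functional *)

Let D : set (T -> R) := [set h : T -> R | nu.-integrable [set: T] (EFin \o h)].

(** A tiling without the marginal constraint; finite size makes [fine] additive and homogeneous on
    sizes. *)
Definition finite_size_weight t := [/\ measurable_fun setT t,
  forall z, 0 <= t z, forall z, t z != 0 -> FFW E W z &
  (tiling_size nu t < +oo)%E].

(* The infimum of these values is the sublinear majorant for Hahn-Banach: a
   constant excess [a] of the budget costs [a * v], any other excess [w] costs
   its integral, and a tiling [t] packed within the budget is credited. *)
Definition budget_values (v : R) (h : T -> R) : set R := [set r |
  exists a t (w : T -> R), [/\ finite_size_weight t /\ 0 <= a,
    D w, forall x, 0 <= w x,
    forall x, ((h x)%:E + marginal_sum t x <= (a + w x)%:E)%E &
    r = a * v + \int[nu]_x w x - fine (tiling_size nu t)]].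

Let tiling_size_ge0 t : (forall z, 0 <= t z) -> (0 <= tiling_size nu t)%E.
Proof. by move=> t0; apply: iter_int_ge0 => z; rewrite lee_fin. Qed.

Let tiling_size_fin t : finite_size_weight t -> tiling_size nu t \is a fin_num.
Proof. by move=> [_ t0 _ too]; rewrite ge0_fin_numE// tiling_size_ge0. Qed.

Let tiling_size0 : tiling_size nu (fun _ : k.-tuple T => 0 : R) = 0%E.
Proof. exact: iter_int_cst. Qed.

Let marginal_sum0 x : marginal_sum (fun=> 0) x = 0%E.
Proof. by rewrite /marginal_sum big1// => l _; exact: iter_int_cst. Qed.

Let finite_size_weight0 : finite_size_weight (fun=> 0).
Proof.
split => //; first by move=> z; rewrite eqxx.
by rewrite tiling_size0 ltry.
Qed.

Let DDh g h : D g -> D h -> D (g + h).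
Proof. exact: integrableD. Qed.

Let DZh r h : D h -> D (r *: h).
Proof. exact: integrableZl. Qed.

Let DN h : D h -> D (fun x => `|h x|).
Proof. exact: integrable_abse. Qed.

Let Dcst r : D (cst r).
Proof. exact: finite_measure_integrable_cst. Qed.

Lemma budget_valuesD v g h r s : D g -> D h ->
  budget_values v g r -> budget_values v h s -> budget_values v (g + h) (r + s).
Proof.
move=> Dg Dh [a [t [w [[ft a0] Dw w0 ineq ->]]]].
move=> [b [t' [w' [[ft' b0] Dw' w'0 ineq' ->]]]].
have [mt t0 tA _] := ft; have [mt' t'0 t'A _] := ft'.
have sizeD : tiling_size nu (t \+ t') = (tiling_size nu t + tiling_size nu t')%E.
  rewrite /tiling_size -ge0_iter_intD//; try exact/measurable_EFinP;
    by move=> z; rewrite lee_fin.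
exists (a + b), (t \+ t'), (w + w'); split.
- split; last exact: addr_ge0.
  split; first exact: measurable_funD.
  + by move=> z; apply: addr_ge0.
  + move=> z /=; have [->|/tA//] := eqVneq (t z) 0.
    by rewrite add0r; exact: t'A.
  + by rewrite sizeD lte_add_pinfty// ltey_eq tiling_size_fin.
- exact: DDh.
- by move=> x; apply: addr_ge0.
- move=> x; rewrite marginal_sumD// [((g + h) x)%:E]EFinD addeACA.
  have -> : (a + b + (w + w') x)%:E = ((a + w x)%:E + (b + w' x)%:E)%E.
    by rewrite -EFinD addrACA.
  exact: leeD.
- rewrite sizeD fineD ?tiling_size_fin// RintegralD//.
  ring.
Qed.

Lemma budget_valuesZ v h r s : 0 < s -> D h ->
  budget_values v h r -> budget_values v (s *: h) (s * r).
Proof.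
move=> s0 Dh [a [t [w [[ft a0] Dw w0 ineq ->]]]].
have [mt t0 tA _] := ft.
have sizeZ : tiling_size nu (fun z => s * t z) = (s%:E * tiling_size nu t)%E.
  rewrite /tiling_size -ge0_iter_intZl//; first exact/measurable_EFinP.
  exact: ltW.
exists (s * a), (fun z => s * t z), (s *: w); split.
- split; last by rewrite mulr_ge0// ltW.
  split; first exact: measurable_funM.
  + by move=> z; rewrite mulr_ge0// ltW.
  + by move=> z; rewrite mulf_eq0 negb_or => /andP[_ /tA].
  + by rewrite sizeZ lte_mul_pinfty// ?lee_fin ?ltW// ltey_eq tiling_size_fin.
- exact: DZh.
- by move=> x; rewrite mulr_ge0// ltW.
- move=> x; rewrite (marginal_sumZ _ mt t0 (ltW s0)) [((s *: h) x)%:E]EFinM -muleDr//.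
  have -> : (s * a + (s *: w) x)%:E = (s%:E * (a + w x)%:E)%E.
    by rewrite -EFinM mulrDr.
  by apply: lee_wpmul2l => //; rewrite lee_fin ltW.
- rewrite sizeZ fineM ?tiling_size_fin//=.
  rewrite (_ : \int[nu]_x (s *: w) x = s * \int[nu]_x w x); first ring.
  exact: RintegralZl.
Qed.

(** * Separation and the resulting cover *)

Section upper_bound.
Variable v : R.
Hypothesis k0 : (0 < k)%N.
Hypothesis tilv : forall t, is_tiling nu E W t -> (tiling_size nu t <= v%:E)%E.

(** Moving $h$ to the right gives $Mt \le a + (w + |h|)$, so [tiling_size_perturbation] bounds $|t|$
    by $av + \int w + \int |h|$. Hence the infimum is finite. *)
Lemma budget_values_lbound h : D h ->
  lbound (budget_values v h) (- \int[nu]_x `|h x|).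
Proof.
move=> Dh _ [a [t [w [[ft a0] Dw w0 ineq ->]]]].
have [mt t0 tA _] := ft.
pose w' := w + (fun x => `|h x|).
have Dw' : D w' by apply: DDh => //; exact: DN.
have mw' : measurable_fun setT w'.
  by apply/measurable_EFinP; exact: measurable_int Dw'.
have := tiling_size_perturbation k0 tilv mt t0 tA a0 mw'.
have w'0 x : 0 <= w' x by apply: addr_ge0 (w0 x) (normr_ge0 _).
have tw' x : (marginal_sum t x <= (a + w' x)%:E)%E.
  have := ineq x; case: (marginal_sum t x) => [m||]//=; last by move=> _; exact: leNye.
  rewrite -EFinD !lee_fin /w' fctE => mle.
  have := ler_norm (- h x); rewrite normrN; lra.
move=> /(_ w'0 tw').
rewrite -(fineK (tiling_size_fin ft)) -(fineK (integrable_fin_num _ Dw'))//.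
rewrite -EFinD lee_fin -/(Rintegral _ _ _) RintegralD//; last exact: DN.
lra.
Qed.

Lemma budget_values_neq0 h : D h -> budget_values v h !=set0.
Proof.
move=> Dh; pose t0 : k.-tuple T -> R := fun=> 0.
exists (0 * v + \int[nu]_x `|h x| - fine (tiling_size nu t0)).
exists 0, t0, (fun x => `|h x|); split => //; first exact: DN.
by move=> x; rewrite marginal_sum0 adde0 lee_fin add0r ler_norm.
Qed.

Lemma sublinear_budget : sublinear_on D (fun h => inf (budget_values v h)).
Proof.
have infle h r : D h -> budget_values v h r -> inf (budget_values v h) <= r.
  move=> Dh hr; apply: ge_inf => //.
  by exists (- \int[nu]_x `|h x|); exact: budget_values_lbound.
split=> [g h Dg Dh|r h r0 Dh].
  rewrite -lerBlDr; apply: lb_le_inf; first exact: budget_values_neq0.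
  move=> x gx; rewrite lerBlDr -lerBlDl.
  apply: lb_le_inf; first exact: budget_values_neq0.
  move=> y hy; rewrite lerBlDl; apply: infle; first exact: DDh.
  exact: budget_valuesD.
rewrite -ler_pdivrMl//; apply: lb_le_inf; first exact: budget_values_neq0.
move=> x hx; rewrite ler_pdivrMl//; apply: infle; first exact: DZh.
exact: budget_valuesZ.
Qed.

Lemma budget_functional : exists l : (T -> R) -> R,
  [/\ forall g h, D g -> D h -> l (g + h) = l g + l h,
      forall r h, D h -> l (r *: h) = r * l h &
      forall h r, D h -> budget_values v h r -> l h <= r].
Proof.
have [l [lD lZ lp]] := hahn_banach DDh DZh sublinear_budget.
exists l; split => // h r Dh hr; apply: le_trans (lp _ Dh) _.
apply: ge_inf => //.
by exists (- \int[nu]_x `|h x|); exact: budget_values_lbound.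
Qed.

(** Every property of the functional [l] is read off from one explicit budget value;
    [positive_functional_density] then supplies [c]. *)
Lemma dual_weight : exists c, [/\ measurable_fun setT c, forall x, 0 <= c x,
  (\int[nu]_x (c x)%:E <= v%:E)%E &
  forall t (h : T -> R), finite_size_weight t -> D h ->
    (forall x, marginal_sum t x = (h x)%:E) ->
    (tiling_size nu t <= \int[nu]_x ((c x)%:E * marginal_sum t x))%E].
Proof.
have [l [lD lZ lle]] := budget_functional.
have lN h : D h -> l (- h) = - l h by move=> Dh; rewrite -scaleN1r lZ// mulN1r.
have l_ge0 h : D h -> (forall x, 0 <= h x) -> 0 <= l h.
  move=> Dh h0; rewrite -oppr_le0 -lN//; apply: lle.
    by rewrite -scaleN1r; exact: DZh.
  (* For $h \ge 0$ the function $-h$ fits in the zero budget, so $l(-h) \le 0$. *)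
  exists 0, (fun=> 0), (cst 0); split => //.
  - by move=> x; rewrite marginal_sum0 adde0 lee_fin addr0 fctE oppr_le0.
  - by rewrite tiling_size0 Rintegral_cst// !mul0r subr0 addr0.
have l_le h : D h -> (forall x, 0 <= h x) -> l h <= \int[nu]_x h x.
  move=> Dh h0; apply: lle => //.
  (* Paying for $h$ entirely through $w = h$ costs its integral. *)
  exists 0, (fun=> 0), h; split => //.
  - by move=> x; rewrite marginal_sum0 adde0 lee_fin add0r.
  - by rewrite tiling_size0 mul0r subr0 add0r.
have [c [mc c0 c1 lc]] := positive_functional_density lD lZ l_ge0 l_le.
exists c; split => //.
  rewrite c1 lee_fin; apply: lle => //.
  (* The constant $1$ is paid through $a = 1$ at cost $v$, whence $\int c = l(1) \le v$. *)
  exists 1, (fun=> 0), (cst 0); split => //.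
  - by move=> x; rewrite marginal_sum0 adde0 lee_fin addr0.
  - by rewrite tiling_size0 Rintegral_cst// mul0r subr0 addr0 mul1r.
move=> t h ft Dh th; have [mt t0 tA too] := ft.
have h0 x : 0 <= h x by rewrite -lee_fin -th marginal_sum_ge0.
have : l (- h) <= - fine (tiling_size nu t).
  apply: lle; first by rewrite -scaleN1r; exact: DZh.
  (* Since $-Mt + Mt = 0$, the weight [t] fits for free and is credited: $l(-Mt) \le -|t|$. *)
  exists 0, t, (cst 0); split => //.
  - by move=> x; rewrite th -EFinD lee_fin fctE addNr addr0.
  - by rewrite Rintegral_cst// !mul0r addr0 add0r.
rewrite lN// lerN2 -lee_fin fineK ?tiling_size_fin// => /le_trans; apply.
apply: le_trans (lc _ Dh h0) _; rewrite le_eqVlt; apply/orP; left; apply/eqP.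
by apply: eq_integral => x _; rewrite th -EFinM mulrC.
Qed.

(** Testing [dual_weight] on $t = 1_B$, with $B$ the part of $\mathcal{F}_F(W)$ where $S < 1$, gives
    $|t| \le \int tS$. As $t(1-S) \ge 0$ is positive exactly on $B$, this forces $B$ to be null. *)
Lemma exists_fcover : exists2 c, is_fcover nu E W c & (\int[nu]_x (c x)%:E <= v%:E)%E.
Proof.
have [c [mc c0 cv ct]] := dual_weight.
pose S z := \sum_(i < k) c (tnth z i).
have S0 z : 0 <= S z by apply: sumr_ge0.
have mS : measurable_fun setT S by exact: measurable_sum_tnth.
pose B := FFW E W `&` [set z | S z < 1].
have mB : measurable B by exact: mdefect.
pose t z : R := \1_B z.
have t01 z : 0 <= t z <= 1 by rewrite /t indicE; case: (_ \in _); rewrite ?lexx ler01.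
have t0 z : 0 <= t z by case/andP: (t01 z).
have t1 z : t z <= 1 by case/andP: (t01 z).
have mt : measurable_fun setT t by exact: measurable_indic.
have marg1 l x : (marginal nu t l x <= 1)%E.
  rewrite -[leRHS](iter_int_cst nu k); apply: ge0_le_iter_int => //.
  - exact: measurable_EFin_upd.
  - by move=> z; rewrite lee_fin.
  - by move=> z; rewrite lee_fin.
have size1 : (tiling_size nu t <= 1)%E.
  rewrite -[leRHS](iter_int_cst nu k); apply: ge0_le_iter_int => //.
  exact/measurable_EFinP.
have ft : finite_size_weight t.
  split => //; last exact: le_lt_trans size1 (ltry 1).
  by move=> z; rewrite /t indicE; have [/set_mem[]//|_] := boolP (z \in B); rewrite eqxx.
pose h x := fine (marginal_sum t x).
have hE x : marginal_sum t x = (h x)%:E.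
  have mfin l : marginal nu t l x \is a fin_num.
    by rewrite ge0_fin_numE ?marginal_ge0// (le_lt_trans (marg1 l x))// ltry.
  by rewrite fineK// sum_fin_num; apply/allP => _ /mapP[l _ ->]; exact: mfin.
(* Each marginal of an indicator is at most $1$, so the marginal sum is bounded by $k$. *)
have Dh : D h.
  apply: (le_integrable measurableT _ _ (Dcst k%:R)).
  - apply/measurable_EFinP; apply: measurableT_comp => //.
    exact: measurable_marginal_sum.
  - move=> x _ /=; have hx0 : 0 <= h x by apply/fine_ge0/marginal_sum_ge0.
    rewrite lee_fin !ger0_norm// -lee_fin -hE.
    apply: (@le_trans _ _ (\sum_(l < k) 1%E)%E); first exact: lee_sum.
    by rewrite sumEFin sumr_const card_ord.
have := ct t h ft Dh hE; rewrite integral_marginal_sum// => sizeS.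
have mtS : measurable_fun setT (fun z => (t z * S z)%:E).
  exact/measurable_EFinP/measurable_funM.
have mtd : measurable_fun setT (fun z => (t z * (1 - S z))%:E).
  by apply/measurable_EFinP; apply: measurable_funM => //; exact: measurable_funB.
have td0 z : (0 <= (t z * (1 - S z))%:E)%E.
  rewrite lee_fin /t indicE; have [/set_mem[_ /= /ltW]|_] := boolP (z \in B).
    by rewrite mul1r subr_ge0.
  by rewrite mul0r.
have size_fin := tiling_size_fin ft.
have split_size : (tiling_size nu t = iter_int nu (fun z => (t z * S z)%:E) +
    iter_int nu (fun z => (t z * (1 - S z))%:E))%E.
  rewrite -ge0_iter_intD//; last by move=> z; rewrite lee_fin mulr_ge0.
  by apply: eq_iter_int => z /=; rewrite -EFinD -mulrDr addrC subrK mulr1.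
(* Finiteness of the size allows cancelling $\int tS$. *)
have defect0 : iter_int nu (fun z => (t z * (1 - S z))%:E) = 0%E.
  apply/eqP; rewrite eq_le iter_int_ge0 ?andbT//.
  have tS0 : (0 <= iter_int nu (fun z => (t z * S z)%:E))%E.
    by apply: iter_int_ge0 => z; rewrite lee_fin mulr_ge0.
  have d0 := iter_int_ge0 nu td0.
  move: sizeS size_fin d0 tS0; rewrite split_size.
  case: (iter_int _ _) => [p||]; case: (iter_int _ _) => [q||]//=.
  rewrite -EFinD !lee_fin; lra.
have B0 : prod_meas nu B = 0%E.
  apply: (iter_int_eq0 mtd td0 _ _ _ defect0).
  - exact/measurable_EFinP.
  - by move=> z; rewrite lee_fin.
  - move=> z [/eqP]; rewrite mulf_eq0 => /orP[/eqP tz|].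
      by congr EFin.
    rewrite subr_eq0 => /eqP S1; congr EFin; rewrite indicE memNset//.
    by move=> [_ /=]; rewrite -S1 ltxx.
exists (fun x => Num.min (c x) 1); last first.
  apply: le_trans cv; apply: ge0_le_integral => //.
  - by move=> x _; rewrite lee_fin le_min c0 ler01.
  - by apply/measurable_EFinP; exact: measurable_minr.
  - exact/measurable_EFinP.
  - by move=> x _; rewrite lee_fin ge_min lexx.
split; first exact: measurable_minr.
  by move=> x; rewrite le_min c0 ler01 ge_min lexx orbT.
(* Truncation at $1$ keeps the defect set: if some $c(z_i) \ge 1$, both sums are at least $1$;
   otherwise they coincide. *)
rewrite -[RHS]B0; congr (prod_meas nu (_ `&` _)); apply/seteqP; split => z /=.
  move=> min1.
  have ci i : c (tnth z i) < 1.
    rewrite ltNge; apply/negP => ci; move: min1; rewrite ltNge => /negP; apply.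
    rewrite (bigD1 i)//= min_r// lerDl sumr_ge0// => j _.
    by rewrite le_min c0 ler01.
  rewrite /S; apply: le_lt_trans min1; apply: ler_sum => i _.
  by rewrite min_l// ltW.
move=> S1; apply: le_lt_trans S1; apply: ler_sum => i _.
by rewrite ge_min lexx.
Qed.

End upper_bound.

End fixed_graph.

End tilings.

(** * The graph without vertices *)

Section empty_graph.
Context {d : measure_display} {T : measurableType d} {R : realType}.
Variables (nu : probability T R) (E : rel 'I_0) (W : T * T -> R).

Let FFW0 (z : 0.-tuple T) : FFW E W z.
Proof. by rewrite /FFW /= /Wtensor big_ord0 oner_neq0. Qed.

(** The space $\Omega^0$ is a single point and no marginal is constrained, so constant tilings have
    arbitrarily large size. *)
Lemma til0 : til nu E W = +oo%E.
Proof.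
apply/eqyP => r r0; apply: ereal_sup_ubound; exists (cst r) => //.
split => //; first by move=> z; exact: ltW.
by move=> x; rewrite big_ord0.
Qed.

(** The empty sum is $0 < 1$ at the only point, which has mass one. So no cover exists, and the
    infimum of the empty set is $+\infty$. *)
Lemma fcov0 : fcov nu E W = +oo%E.
Proof.
rewrite /fcov (_ : [set _ | _ in _] = set0) ?ereal_inf0//.
apply/seteqP; split => // x [c [_ _ c0] _].
move: c0; rewrite /prod_meas /= indicE mem_set; last first.
  by split; [exact: FFW0|rewrite /= big_ord0].
by move/eqP; rewrite onee_eq0.
Qed.

End empty_graph.

(** * Equality of the two values *)

Theorem theorem3p16 (d : measure_display) (T : measurableType d) (R : realType)
    (nu : probability T R)
    (Hborel : @standard_borel d T R) (Hatomless : atomless nu)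
    (W : T * T -> R) (HW : graphon W)
    (k : nat) (E : rel 'I_k) (Esym : symmetric E) (Eirr : irreflexive E) :
  til nu E W = fcov nu E W.
Proof.
have [mW _ _] := HW.
case: k E {Esym Eirr} => [|k] E; first by rewrite til0 fcov0.
have tilP t : is_tiling nu E W t -> (tiling_size nu t <= til nu E W)%E.
  by move=> tt; apply: ereal_sup_ubound; exists t.
have til_ge0 : (0 <= til nu E W)%E.
  rewrite -[leLHS](iter_int_cst nu k.+1); apply: (tilP (cst 0)).
  split => //; first by move=> z; rewrite eqxx.
  by move=> x; rewrite big1 ?lee01// => l _; exact: (iter_int_cst nu k.+1 0%:E).
(* Integrating $Mt \le 1$ shows that the supremum is finite, so its real value can serve as $v$ in
   [exists_fcover]. *)
have til_le1 : (til nu E W <= 1)%E.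
  apply: ge_ereal_sup => _ [t [mt t0 _ tM] <-].
  apply: le_trans (tiling_size_le_marginal_sum nu (ltn0Sn k) mt t0) _.
  rewrite -[leRHS](integral_probability_cst nu); apply: ge0_le_integral => //.
  - by move=> x _; exact: marginal_sum_ge0.
  - exact: measurable_marginal_sum.
  - by move=> x _; exact: tM.
apply/eqP; rewrite eq_le; apply/andP; split.
  apply: ge_ereal_sup => _ [t tt <-]; apply: le_ereal_inf_tmp => _ [c cc <-].
  exact: (tiling_size_le_fcover mW tt cc).
have til_fin : til nu E W \is a fin_num.
  by rewrite ge0_fin_numE// (le_lt_trans til_le1)// ltry.
have tilP' t : is_tiling nu E W t -> (tiling_size nu t <= (fine (til nu E W))%:E)%E.
  by rewrite fineK//; exact: tilP.
have [c cc cle] := exists_fcover mW (ltn0Sn k) tilP'.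
rewrite fineK// in cle; apply: le_trans cle.
by apply: ereal_inf_lbound; exists c.
Qed.
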